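(* For every integer $t\geq 1$, every graph $G$ that does not contain $K^*_{2,t}$ as a minor is $3$-colourable with clustering $t-1$. Moreover, for each edge $vw$ of $G$, there is such a $3$-colouring in which $v$ and $w$ are both isolated vertices in their respective monochromatic subgraphs.
   Context: All graphs are finite and simple. $K^*_{2,t}$ denotes the graph consisting of an edge together with $t$ pairwise non-adjacent vertices each adjacent to both endpoints of that edge (the complete join of $K_2$ and $\overline{K_t}$). A graph is $k$-colourable with clustering $c$ if its vertices can be assigned one of $k$ colours (not necessarily properly) so that every connected component of the subgraph induced by each colour class has at most $c$ vertices. The monochromatic subgraph of a vertex is the subgraph induced by all vertices of its colour.
   Formalization: For t = 1 the claimed clustering t−1 = 0 is impossible for any nonempty graph (e.g. a single vertex), so the clustering bound is taken to be max(1, t−1), which equals t−1 for all t ≥ 2. *)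

(* Defs.v *)
From mathcomp Require Import all_boot.

Set Implicit Arguments.
Unset Strict Implicit.
Unset Printing Implicit Defensive.

Record sgraph := SGraph {
  vertex :> finType;
  adj : rel vertex;
  adj_sym : symmetric adj;
  adj_irr : irreflexive adj }.

Definition induced_adj (G : sgraph) (S : {set G}) : rel G :=
  [rel x y | [&& x \in S, y \in S & adj x y]].

Definition connected_set (G : sgraph) (S : {set G}) : Prop :=
  S != set0 /\ {in S &, forall x y, connect (induced_adj S) x y}.

(* The vertex sets of the connected components of G[S]. *)
Definition components (G : sgraph) (S : {set G}) : {set {set G}} :=
  equivalence_partition (connect (induced_adj S)) S.

(* H is a minor of G: phi assigns to each vertex of H its branch set in G. *)
Definition has_minor (G H : sgraph) : Prop :=
  exists phi : H -> {set G},
    [/\ forall a, connected_set (phi a),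
        forall a b, a != b -> [disjoint phi a & phi b]
      & forall a b, adj a b ->
          exists x y, [/\ x \in phi a, y \in phi b & adj x y]].

(* The summand 'I_2 carries the edge, 'I_t the t pairwise non-adjacent
   vertices. *)
Definition K2star_adj (t : nat) : rel ('I_2 + 'I_t)%type :=
  fun x y =>
    match x, y with
    | inl i, inl j => i != j
    | inr _, inr _ => false
    | _, _ => true
    end.

Lemma K2star_sym (t : nat) : symmetric (@K2star_adj t).
Proof. by move=> [i|i] [j|j] //=; rewrite eq_sym. Qed.

Lemma K2star_irr (t : nat) : irreflexive (@K2star_adj t).
Proof. by move=> [i|i] //=; rewrite eqxx. Qed.

Definition K2star (t : nat) : sgraph :=
  SGraph (@K2star_sym t) (@K2star_irr t).

Definition colour_class (G : sgraph) (k : nat) (c : G -> 'I_k) (i : 'I_k) :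
  {set G} := [set x | c x == i].

Definition has_clustering (G : sgraph) (k : nat) (c : G -> 'I_k) (m : nat) :
  Prop :=
  forall (i : 'I_k) (C : {set G}),
    C \in components (colour_class c i) -> #|C| <= m.

Definition colourable_with_clustering (G : sgraph) (k m : nat) : Prop :=
  exists c : G -> 'I_k, has_clustering c m.

Definition mono_isolated (G : sgraph) (k : nat) (c : G -> 'I_k) (v : G) :
  Prop :=
  forall x, x \in colour_class c (c v) -> ~~ adj v x.

(* The clustering value t - 1, except that t = 1 gives 1: a nonempty graph has
   no colouring with clustering 0, while the graphs without a K2star 1 minor
   are exactly the forests. *)
Definition clustering_bound (t : nat) : nat := maxn 1 (t - 1).

(* Main.v *)
(* Colour v with 0 and w with 1, and let A and B be the neighbourhoods of v and
   w in the rest R of the graph. Contracting t disjoint A-B connectors would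
   give a K2star t minor, so by Menger's theorem a minimal set S separating A
   from B in R has fewer than t vertices; give S colour 2. By minimality S
   attaches to v through the part RX of R - S reachable from A, and to w through
   the part reachable from B. Hence recursion applies to RX with the adjacent
   connected sets {v} and "everything on the side of w, with S" in the roles of
   v and w, which keeps colour 0 off the neighbours of v and colour 2 off the
   neighbours of S; symmetrically for the remainder of R - S. Allowing connected
   sets in place of v and w avoids forming contracted graphs. *)

Require Import Defs.
From mathcomp Require Import all_boot.

Set Implicit Arguments.
Unset Strict Implicit.
Unset Printing Implicit Defensive.

Lemma disjoint_setP (T : finType) (A B : {set T}) :
  reflect (forall z, z \in A -> z \in B -> False) [disjoint A & B].
Proof.
rewrite disjoint_subset; apply: (iffP subsetP) => [sAB z /sAB|dAB z zA].
  by rewrite inE => /negP.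
by rewrite inE; apply/negP; apply: dAB.
Qed.

(** * Menger's theorem *)

Section Reach.
Variable T : finType.
Implicit Types (e : rel T) (W P : {set T}).

(** * Reachability inside a vertex set *)

(** [connect] is reflexive everywhere, so the test [a \in W] is what excludes the trivial walk at a
    vertex outside [W]. *)
Definition reach e W (a b : T) : bool :=
  (a \in W) && connect [rel x y | [&& x \in W, y \in W & e x y]] a b.

Lemma reach_refl e W a : a \in W -> reach e W a a.
Proof. by move=> aW; rewrite /reach aW connect0. Qed.

Lemma reach_in e W a b : reach e W a b -> a \in W.
Proof. by case/andP. Qed.

Lemma reach_ind e W a (Q : T -> Prop) :
    (a \in W -> Q a) ->
    (forall u v, reach e W a u -> u \in W -> Q u -> v \in W -> e u v -> Q v) ->
  forall b, reach e W a b -> Q b.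
Proof.
move=> Qa Qs b /andP[aW /connectP[p]].
elim/last_ind: p b => [|p v IH] b /=; first by move=> _ ->; apply: Qa.
rewrite rcons_path last_rcons => /andP[pp /and3P[uW vW euv]] ->.
apply: (Qs (last a p)) => //; last exact: IH.
by rewrite /reach aW; apply/connectP; exists p.
Qed.

Lemma reach_out e W a b : reach e W a b -> b \in W.
Proof. by elim/reach_ind. Qed.

Lemma reach_trans e W a b d : reach e W a b -> reach e W b d -> reach e W a d.
Proof. by case/andP=> aW ab /andP[_ bd]; rewrite /reach aW (connect_trans ab). Qed.

Lemma reach_step e W a u v : reach e W a u -> v \in W -> e u v -> reach e W a v.
Proof.
move=> au vW euv; apply: (reach_trans au).
have uW := reach_out au.
by rewrite /reach uW connect1 //= uW vW.
Qed.

Lemma reach_sub e e' W W' a b :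
    {subset W <= W'} -> {in W &, subrel e e'} ->
  reach e W a b -> reach e' W' a b.
Proof.
move=> sW se; elim/reach_ind => [aW|u v _ uW IH vW euv].
  by rewrite reach_refl ?sW.
by apply: (reach_step IH); rewrite ?sW ?se.
Qed.

Lemma reach_subset e W W' a b :
  {subset W <= W'} -> reach e W a b -> reach e W' a b.
Proof. by move=> sW; apply: reach_sub. Qed.

Lemma reach_reached e W a b :
  reach e W a b -> reach e [set z | reach e W a z] a b.
Proof.
elim/reach_ind => [aW|u v au _ IH vW euv].
  by rewrite reach_refl ?inE ?reach_refl.
by apply: (reach_step IH) => //; rewrite inE (reach_step au).
Qed.

Definition conv e : rel T := [rel x y | e y x].

Lemma reach_conv e W a b : reach (conv e) W a b = reach e W b a.
Proof.
suff H e' c d : reach e' W c d -> reach (conv e') W d c.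
  by apply/idP/idP; [move=> /H; apply: reach_sub | apply: H].
elim/reach_ind => [cW|u v _ uW IH vW euv]; first exact: reach_refl.
by apply: reach_trans IH; apply: (reach_step (reach_refl _ vW)).
Qed.

Lemma reach_sym e W : symmetric e -> symmetric (reach e W).
Proof.
move=> se a b; rewrite -reach_conv.
by apply/idP/idP; apply: reach_sub => // x y _ _; rewrite /= se.
Qed.

(** Follow the walk from [a]: as long as it has not met [P], its vertices are reached outside [P].
    The case [a = p] is a walk that starts in [P]. *)
Lemma reach_first_hit e W P a b :
    reach e W a b -> ~~ reach e (W :\: P) a b ->
  exists p, [/\ p \in P, p \in W &
    a = p \/ exists2 u, reach e (W :\: P) a u & e u p].
Proof.
move=> ab nab; have aW := reach_in ab.
have [aP|aP] := boolP (a \in P); first by exists a; split=> //; left.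
suff: reach e (W :\: P) a b \/ exists p, [/\ p \in P, p \in W &
    a = p \/ exists2 u, reach e (W :\: P) a u & e u p].
  by case=> //; rewrite (negPf nab).
elim/reach_ind: ab => [_|u v _ uW IH vW euv].
  by left; rewrite reach_refl // inE aP.
case: IH => [au|]; last by right.
have [vP|vP] := boolP (v \in P); last by left; rewrite (reach_step au) ?inE ?vP.
by right; exists v; split=> //; right; exists u.
Qed.

(** * Disjoint connectors between two sets *)

Definition linked e (A B C : {set T}) : bool :=
  [exists a in A, exists b in B, reach e C a b].

Lemma linkedP e (A B C : {set T}) :
  reflect (exists a b, [/\ a \in A, b \in B & reach e C a b]) (linked e A B C).
Proof.
apply: (iffP exists_inP) => [[a aA /exists_inP[b bB ab]]|[a [b [aA bB ab]]]].
  by exists a, b.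
by exists a => //; apply/exists_inP; exists b.
Qed.

Lemma linked_conv e (A B C : {set T}) : linked (conv e) A B C = linked e B A C.
Proof.
by apply/linkedP/linkedP => -[a [b [aA bB ab]]]; exists b, a; split=> //;
  move: ab; rewrite reach_conv.
Qed.

Lemma linked_sub e e' (A B C C' : {set T}) :
    {subset C <= C'} -> {in C &, subrel e e'} ->
  linked e A B C -> linked e' A B C'.
Proof.
move=> sC se /linkedP[a [b [aA bB ab]]]; apply/linkedP; exists a, b.
by split=> //; apply: reach_sub ab.
Qed.

(** Disjoint vertex sets, each containing a walk from [A] to [B], stand for disjoint paths. Indices
    are vertices, so that connectors can be indexed by their ends in a separator. *)
Definition linkage e (A B : {set T}) (k : nat) : Prop :=
  exists (I : {set T}) (C : T -> {set T}),
    [/\ k <= #|I|, {in I, forall i, linked e A B (C i)}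
      & {in I &, forall i j, i != j -> [disjoint C i & C j]}].

Lemma linkage_conv e (A B : {set T}) k : linkage e A B k -> linkage (conv e) B A k.
Proof.
case=> I [C [kI lC dC]]; exists I, C; split=> // i iI.
by rewrite linked_conv lC.
Qed.

(** Choosing an end in [P] for each connector is injective by disjointness. As [P] has at most [k]
    elements, the choice is a bijection onto [P], and its inverse reindexes the connectors. *)
Lemma linkage_terminals e (A P : {set T}) k :
    linkage e A P k -> #|P| <= k ->
  exists C : T -> {set T},
    {in P, forall p, linked e A [set p] (C p)} /\
    {in P &, forall p q, p != q -> [disjoint C p & C q]}.
Proof.
case=> I [C [kI lC dC]] Pk.
pose f i := odflt i [pick p in P | linked e A [set p] (C i)].
have fP i : i \in I -> f i \in P /\ linked e A [set f i] (C i).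
  move=> iI; rewrite /f; case: pickP => [p /andP[]//|nop].
  have /linkedP[a [b [aA bP ab]]] := lC i iI.
  have /negP[] := negbT (nop b); rewrite bP /=.
  by apply/linkedP; exists a, b; rewrite inE eqxx.
have fC i : i \in I -> f i \in C i.
  by case/fP=> _ /linkedP[a [b [_ /set1P-> /reach_out]]].
have finj : {in I &, injective f}.
  move=> i j iI jI fij; apply/eqP; apply/negPn/negP => nij.
  have /disjoint_setP /(_ (f i)) := dC i j iI jI nij.
  by case; [apply: fC | rewrite fij; apply: fC].
have fI : f @: I = P.
  apply/eqP; rewrite eqEcard card_in_imset // (leq_trans Pk) // andbT.
  by apply/subsetP=> _ /imsetP[i iI ->]; case: (fP i iI).
pose g p := odflt p [pick i in I | f i == p].
have gP p : p \in P -> g p \in I /\ f (g p) = p.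
  rewrite -fI => /imsetP[i iI ->]; rewrite /g.
  case: pickP => [j /andP[jI /eqP]//|/(_ i)].
  by rewrite iI eqxx.
exists (C \o g); split=> [p /gP[gI {1}<-]|p q /gP[pI fp] /gP[qI fq] npq].
  by case: (fP _ gI).
apply: dC => //; apply: contra npq => /eqP gpq.
by rewrite -fp gpq fq.
Qed.

(* Truncating each connector at its first vertex in P makes all its other
   vertices reachable from A in the complement of P. *)
Lemma linkage_truncated e (A P : {set T}) k :
    linkage e A P k -> #|P| <= k ->
  exists C : T -> {set T},
    [/\ {in P, forall p, linked e A [set p] (C p)},
        {in P &, forall p q, p != q -> [disjoint C p & C q]}
      & forall S : {set T}, S \subset P -> {in P, forall p z,
          z \in C p -> z \notin S -> linked e A [set z] (~: S)}].
Proof.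
move=> lk Pk; have [C [lC dC]] := linkage_terminals lk Pk.
have Cp p : p \in P -> p \in C p.
  by move=> /lC /linkedP[a [b [_ /set1P-> /reach_out]]].
(* Every [q] in [P] already lies in its own connector, so [C p] meets [P] only in [p]. *)
have CP p q : p \in P -> q \in P -> q \in C p -> q = p.
  move=> pP qP qC; apply/eqP/negPn/negP => nqp.
  by have /disjoint_setP /(_ q (Cp q qP)) := dC q p qP pP nqp.
pose D p := p |: [set z | linked e A [set z] (C p :\: P)].
have DC p : p \in P -> D p \subset C p.
  move=> pP; apply/subsetP=> z; rewrite !inE => /predU1P[->|]; first exact: Cp.
  by case/linkedP=> [a [b [_ /set1P-> /reach_out]]]; rewrite inE => /andP[].
have lD p : p \in P -> linked e A [set p] (D p).
  move=> pP; have /linkedP[a [b [aA /set1P-> ap]]] := lC p pP.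
  apply/linkedP; exists a, p; split; rewrite ?inE //.
  have [|q [qP qC]] := reach_first_hit (P := P) ap.
    by apply/negP => /reach_out; rewrite inE pP.
  have {q qP qC}-> : q = p by apply: CP.
  case=> [->|[u au eup]]; first by rewrite reach_refl // !inE eqxx.
  apply: (@reach_step _ _ _ u) => //; last by rewrite !inE eqxx.
  apply: reach_subset (reach_reached au) => z; rewrite !inE => az.
  by apply/orP; right; apply/linkedP; exists a, z; rewrite inE eqxx.
exists D; split=> // [p q pP qP npq|S SP p pP z zD zS].
  have := dC p q pP qP npq; apply: disjointW; exact: DC.
have [zp|nzp] := eqVneq z p.
  rewrite zp; apply: linked_sub (lD p pP) => // y yD.
  rewrite inE; apply/negP => yS.
  have yp : y = p by apply: CP => //; [apply: (subsetP SP) | apply: (subsetP (DC p pP))].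
  by move: zS; rewrite zp -yp yS.
move: zD; rewrite !inE (negPf nzp) /=; apply: linked_sub => // y.
by rewrite !inE => /andP[yP _]; apply: contra yP; apply: (subsetP SP).
Qed.

(** * Separators and the min-max theorem *)

(** A walk from [A] to [B] avoiding [Z] must meet [P]. Up to the first meeting all its arcs leave
    vertices outside [P], hence belong to [e'], and link [A] to [P]. *)
Lemma separator_transfer e e' (A B P Z : {set T}) :
    ~~ linked e A B (~: P) -> (forall u v, u \notin P -> e u v -> e' u v) ->
  ~~ linked e' A P (~: Z) -> ~~ linked e A B (~: Z).
Proof.
move=> sP se; apply: contra => /linkedP[a [b [aA bB ab]]].
have [|p [pP pZ hp]] := reach_first_hit (P := P) ab.
  apply: contra sP => ab'; apply/linkedP; exists a, b; split=> //.
  by apply: reach_subset ab' => z; rewrite !inE => /andP[].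
apply/linkedP; exists a, p; split=> //.
case: hp => [->|[u au eup]]; first exact: reach_refl.
have uP : u \notin P by move/reach_out: (au); rewrite inE => /andP[].
apply: (@reach_step _ _ _ u) => //; last exact: se.
apply: reach_sub au => [z|x y xP _ exy]; first by rewrite inE => /andP[].
by apply: se => //; move: xP; rewrite inE => /andP[].
Qed.

(* Goering's proof: delete an arc (x, y). If some S with fewer than k elements
   separates A from B afterwards, glue k disjoint connectors from A to x |: S
   with k disjoint connectors from y |: S to B. *)
Theorem menger e (A B : {set T}) k :
    (forall S : {set T}, ~~ linked e A B (~: S) -> k <= #|S|) ->
  linkage e A B k.
Proof.
have [n] := ubnP #|[set d : T * T | e d.1 d.2]|.
elim: n e A B => // n IH e A B en minS.
have [/existsP[[x y] /= exy]|noe] := boolP [exists d : T * T, e d.1 d.2]; last first.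
  (* Without arcs the only connectors are single vertices of [A :&: B], which is itself a
     separator. *)
  exists (A :&: B), (fun i => [set i]); split.
  - apply: minS; apply/negP=> /linkedP[a [b [aA bB ab]]].
    have: a = b.
      elim/reach_ind: ab => // u v _ _ _ _ euv.
      by case/existsP: noe; exists (u, v).
    by move=> eab; move/reach_out: ab; rewrite !inE bB -eab aA.
  - move=> i /setIP[iA iB]; apply/linkedP; exists i, i; split=> //.
    by rewrite reach_refl ?inE.
  - by move=> i j _ _ nij; rewrite disjoints1 inE.
pose e' := [rel u v | e u v && ((u, v) != (x, y))].
have e'e : subrel e' e by move=> u v /andP[].
have {}IH := IH e'.
have e'n : #|[set d : T * T | e' d.1 d.2]| < n.
  rewrite -ltnS; apply: leq_trans en; rewrite ltnS; apply: proper_card.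
  apply/properP; split.
    by apply/subsetP=> d; rewrite !inE => /andP[].
  by exists (x, y); rewrite !inE //= eqxx andbF.
have [/existsP[S /andP[sS Sk]]|noS] :=
  boolP [exists S : {set T}, ~~ linked e' A B (~: S) && (#|S| < k)]; last first.
  have [|I [C [kI lC dC]]] := IH A B e'n.
    move=> S sS; rewrite leqNgt; apply: contra noS => Sk.
    by apply/existsP; exists S; rewrite sS.
  exists I, C; split=> // i /lC; apply: linked_sub => // u v _ _; exact: e'e.
(* Removing either end of the arc (x, y) makes that arc unusable, so [e] and [e'] agree on what
   remains. *)
have sepP : ~~ linked e A B (~: (x |: S)).
  apply: contra sS; apply: linked_sub => [z|u v uP _ euv].
    by rewrite !inE negb_or => /andP[].
  move: uP; rewrite /= euv !inE negb_or => /andP[ux _].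
  by apply: contra ux => /eqP[-> _].
have sepQ : ~~ linked e A B (~: (y |: S)).
  apply: contra sS; apply: linked_sub => [z|u v _ vP euv].
    by rewrite !inE negb_or => /andP[].
  move: vP; rewrite /= euv !inE negb_or => /andP[vy _].
  by apply: contra vy => /eqP[_ ->].
have cS z : #|z |: S| <= k by rewrite cardsU1; case: (z \in S) => //=; apply: ltnW.
(* Otherwise [S] itself would separate [A] from [B] for [e], with fewer than [k] elements. *)
have xS : x \notin S.
  apply: contraL Sk => xS; rewrite -leqNgt; apply: minS.
  by move: sepP; rewrite (setUidPr _) ?sub1set.
have yS : y \notin S.
  apply: contraL Sk => yS; rewrite -leqNgt; apply: minS.
  by move: sepQ; rewrite (setUidPr _) ?sub1set.
have lP : linkage e' A (x |: S) k.
  apply: IH => // Z sZ; apply: minS; apply: separator_transfer sZ => // u v.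
  rewrite !inE negb_or => /andP[ux _] euv /=; rewrite euv.
  by apply: contra ux => /eqP[-> _].
(* The previous argument in the reversed digraph, where the deleted arc leaves [y]. *)
have lQ : linkage e' (y |: S) B k.
  apply: IH => // Z sZ; apply: minS; rewrite -linked_conv.
  have sQ : ~~ linked (conv e) B A (~: (y |: S)) by rewrite linked_conv.
  have sZ' : ~~ linked (conv e') B (y |: S) (~: Z) by rewrite linked_conv.
  apply: separator_transfer sQ _ sZ' => u v.
  rewrite !inE negb_or => /andP[uy _] ; rewrite /conv /= => ->.
  by apply: contra uy => /eqP[_ ->].
have [C [lC dC sC]] := linkage_truncated lP (cS x).
have [D [lD dD sD]] := linkage_truncated (linkage_conv lQ) (cS y).
have Sx : S \subset x |: S by apply: subsetUr.
have Sy : S \subset y |: S by apply: subsetUr.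
have Cp p : p \in x |: S -> p \in C p.
  by move=> /lC /linkedP[a [b [_ /set1P-> /reach_out]]].
have Dp p : p \in y |: S -> p \in D p.
  by move=> /lD /linkedP[a [b [_ /set1P-> /reach_out]]].
(* A common vertex outside [S] would join [A] to [B] in [e'] while avoiding [S]. *)
have meetS p q z : p \in x |: S -> q \in y |: S -> z \in C p -> z \in D q ->
    z = p /\ z = q.
  move=> pP qQ zC zD.
  have [zS|zS] := boolP (z \in S).
    have zP : z \in x |: S by apply: (subsetP Sx).
    have zQ : z \in y |: S by apply: (subsetP Sy).
    split; apply/eqP/negPn/negP => nz.
      by have /disjoint_setP /(_ z (Cp z zP)) := dC z p zP pP nz.
    by have /disjoint_setP /(_ z (Dp z zQ)) := dD z q zQ qQ nz.
  case/negP: sS.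
  have /linkedP[a [z1 [aA /set1P-> az]]] := sC S Sx p pP z zC zS.
  have /linkedP[b [z2 [bB /set1P-> bz]]] := sD S Sy q qQ z zD zS.
  apply/linkedP; exists a, b; split=> //; apply: reach_trans az _.
  by rewrite -reach_conv.
(* Gluing rule: connectors ending at a vertex of [S] continue from that vertex, and the one ending
   at [x] crosses the deleted arc to [y]. *)
pose phi p := if p == x then y else p.
have phiQ p : p \in x |: S -> phi p \in y |: S.
  rewrite /phi; case: eqP => [_ _|/eqP px]; first by rewrite !inE eqxx.
  by rewrite !inE (negPf px) /= => ->; rewrite orbT.
have phi_inj p q : p \in x |: S -> q \in x |: S -> phi p = phi q -> p = q.
  rewrite /phi !inE.
  case: eqP => [->|_]; case: eqP => [->|_] //= pS qS; move=> E.
    by rewrite -E (negPf yS) in qS.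
  by rewrite E (negPf yS) in pS.
have phi_meet p q : p \in x |: S -> p = phi q -> phi p = p.
  rewrite /phi; case: (eqVneq p x) => [->|//] _; case: eqP => // /eqP qx E.
  by rewrite E eqxx in qx.
exists (x |: S), (fun p => C p :|: D (phi p)); split.
- exact: minS.
- move=> p pP.
  have /linkedP[a [p' [aA /set1P-> ap]]] := lC p pP.
  have /linkedP[b [q [bB /set1P-> bq]]] := lD _ (phiQ p pP).
  apply/linkedP; exists a, b; split=> //.
  have ap' : reach e (C p :|: D (phi p)) a p.
    by apply: reach_sub ap => [z|u v _ _ /e'e]; rewrite // inE => ->.
  have qb : reach e (C p :|: D (phi p)) (phi p) b.
    rewrite reach_conv in bq.
    by apply: reach_sub bq => [z|u v _ _ /e'e]; rewrite // inE => ->; rewrite orbT.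
  apply: (reach_trans _ qb).
  have [px|px] := eqVneq p x; last by rewrite {2}/phi (negPf px).
  by apply: (reach_step ap' (reach_in qb)); rewrite /phi px eqxx.
(* In the mixed cases the common vertex is both [p] and [phi q] (or symmetrically); it is then fixed
   by [phi], and injectivity gives [p = q]. *)
move=> p q pP qP npq; apply/disjoint_setP=> z /setUP[zp|zp] /setUP[zq|zq].
- by have /disjoint_setP /(_ z zp) := dC p q pP qP npq.
- have [zp' zq'] := meetS _ _ _ pP (phiQ q qP) zp zq.
  have pq := etrans (esym zp') zq'.
  by case/eqP: npq; apply: phi_inj; rewrite ?(phi_meet _ _ pP pq).
- have [zq' zp'] := meetS _ _ _ qP (phiQ p pP) zq zp.
  have qp := etrans (esym zq') zp'.
  by case/eqP: npq; apply: phi_inj; rewrite ?(phi_meet _ _ qP qp).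
have npq' : phi p != phi q by apply: contra npq => /eqP /phi_inj ->.
by have /disjoint_setP /(_ z zp) := dD _ _ (phiQ p pP) (phiQ q qP) npq'.
Qed.

(** Some separator has fewer than [k] elements; an inclusion-minimal one inside it keeps the bound,
    and returning any [s] reopens a walk. *)
Lemma minimal_separator e (A B : {set T}) k : ~ linkage e A B k ->
  exists S : {set T}, [/\ #|S| < k, ~~ linked e A B (~: S) &
    {in S, forall s, linked e A B (~: (S :\ s))}].
Proof.
move=> nl; pose Q (S : {set T}) := ~~ linked e A B (~: S).
have [/existsP[S0 /andP[S0k sS0]]|noS] :=
  boolP [exists S : {set T}, (#|S| < k) && Q S]; last first.
  case: nl; apply: menger => S sS; rewrite leqNgt; apply: contra noS => Sk.
  by apply/existsP; exists S; rewrite Sk.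
have [S /minsetP[sS minS] SS0] := minset_exists sS0.
exists S; split=> // [|s sinS]; first exact: leq_ltn_trans (subset_leq_card SS0) S0k.
apply: contraT => sSs; have /setP/(_ s) := minS _ sSs (subD1set _ _).
by rewrite !inE eqxx sinS.
Qed.

End Reach.

(** * Colouring around a pair of connected sets *)

Section Colouring.
Variable G : sgraph.
Implicit Types (R S W X Y Z K : {set G}).

Local Notation reach_adj := (reach (@adj G)).

(** * Connected vertex sets *)

Lemma reach_adj_sym W : symmetric (reach_adj W).
Proof. exact: reach_sym (@adj_sym G). Qed.

(** Translates walks of [induced_adj R], a relation on all vertices to which the min-max theorem
    applies, into walks of [G] inside [R]. *)
Lemma reach_induced R W a b :
  a \in R -> reach (induced_adj R) W a b = reach_adj (W :&: R) a b.
Proof.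
move=> aR; apply/idP/idP => [|ab].
  elim/reach_ind => [aW|u v _ _ IH vW /and3P[uR vR uv]].
    by rewrite reach_refl ?inE ?aW.
  by rewrite (reach_step IH) ?inE ?vW.
apply: reach_sub ab => [z|x y]; first by case/setIP.
by move=> /setIP[_ xR] /setIP[_ yR] xy; apply/and3P; split.
Qed.

(* Unlike a connected set, a weakly connected set may be empty. *)
Definition weakly_connected W : Prop := {in W &, forall x y, reach_adj W x y}.

Lemma weakly_connected_set W x : x \in W -> weakly_connected W -> connected_set W.
Proof.
move=> xW cW; split; first by apply/set0Pn; exists x.
by move=> y z yW zW; case/andP: (cW y z yW zW).
Qed.

Lemma reached_connected W a : a \in W -> connected_set [set z | reach_adj W a z].
Proof.
move=> aW; apply: (@weakly_connected_set _ a); first by rewrite inE reach_refl.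
move=> x y; rewrite !inE => /reach_reached ax /reach_reached ay.
by apply: reach_trans ay; rewrite reach_adj_sym.
Qed.

Lemma connected_closed K Z x :
    connected_set K -> x \in K -> x \in Z ->
    {in K &, forall u v, u \in Z -> adj u v -> v \in Z} ->
  K \subset Z.
Proof.
move=> [_ cK] xK xZ clZ; apply/subsetP=> y yK.
have: reach_adj K x y by rewrite /reach xK; apply: cK.
by elim/reach_ind => // u v _ uK uZ vK uv; apply: clZ uv.
Qed.

Definition nbhd X : {set G} := [set z | [exists x in X, adj x z]].

Lemma nbhdP X z : reflect (exists2 x, x \in X & adj x z) (z \in nbhd X).
Proof. by rewrite inE; apply: exists_inP. Qed.

Lemma weakly_connected_attach X Z :
    weakly_connected X ->
    {in Z, forall z, exists2 x, x \in X & reach_adj (X :|: Z) x z} ->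
  weakly_connected (X :|: Z).
Proof.
move=> cX cZ.
have root z : z \in X :|: Z -> exists2 x, x \in X & reach_adj (X :|: Z) x z.
  by case/setUP=> [zX|/cZ//]; exists z => //; rewrite reach_refl ?inE ?zX.
move=> y z /root[x xX xy] /root[x' xX' xz].
apply: reach_trans xz; apply: (@reach_trans _ _ _ _ x); first by rewrite reach_adj_sym.
by apply: reach_subset (cX x x' xX xX') => u uX; rewrite inE uX.
Qed.

(** * The side of a separator *)

(** The union of the components of [R :\: S] that contain a neighbour of [X]. *)
Definition side R X S : {set G} :=
  [set z | linked (@adj G) (nbhd X :&: R) [set z] (R :\: S)].

Lemma sideP R X S z :
  reflect (exists2 a, a \in nbhd X :&: R & reach_adj (R :\: S) a z)
          (z \in side R X S).
Proof.
rewrite inE; apply: (iffP (linkedP _ _ _ _)) => [[a [b [aA /set1P-> az]]]|[a aA az]].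
  by exists a.
by exists a, z; rewrite inE eqxx.
Qed.

Lemma side_sub R X S : side R X S \subset R :\: S.
Proof. by apply/subsetP=> z /sideP[a _ /reach_out]. Qed.

Lemma side_closed R X S u v :
  u \in side R X S -> v \in R :\: S -> adj u v -> v \in side R X S.
Proof.
by case/sideP=> a aA au vW uv; apply/sideP; exists a => //; apply: reach_step uv.
Qed.

Lemma nbhd_side R X S z :
  z \in nbhd X -> z \in R :\: S -> z \in side R X S.
Proof.
move=> zX zR; apply/sideP; exists z; last exact: reach_refl.
by rewrite inE zX; case/setDP: zR.
Qed.

(** By minimality each [s] in [S] lies on a walk from a neighbour of [X] to [B] that meets [S] only
    in [s]. Its part before [s] lies in the side of [X] and attaches [s] to [X]. *)
Lemma weakly_connected_side R X S B :
    weakly_connected X -> ~~ linked (@adj G) (nbhd X :&: R) B (R :\: S) ->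
    {in S, forall s, linked (@adj G) (nbhd X :&: R) B (R :\: (S :\ s))} ->
  weakly_connected (X :|: (S :|: side R X S)).
Proof.
move=> cX sepS minS; set Z := S :|: _; apply: weakly_connected_attach => //.
have near z : z \in nbhd X -> z \in Z ->
    exists2 x, x \in X & reach_adj (X :|: Z) x z.
  move=> /nbhdP[x xX xz] zZ; exists x => //.
  by apply: reach_step xz; [apply: reach_refl; rewrite inE xX | rewrite inE zZ orbT].
have sidez z : z \in side R X S -> exists2 x, x \in X & reach_adj (X :|: Z) x z.
  case/sideP=> a aA; elim/reach_ind => [aW|u v au _ [x xX xu] vW uv].
    have aS : a \in side R X S by apply: nbhd_side => //; case/setIP: aA.
    by apply: near; [case/setIP: aA | rewrite inE aS orbT].
  have vS : v \in side R X S.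
    by apply/sideP; exists a => //; apply: reach_step au vW uv.
  by exists x => //; apply: reach_step xu _ uv; rewrite in_setU [v \in Z]in_setU vS !orbT.
move=> z /setUP[zS|]; last exact: sidez.
have /linkedP[a [b [aA bB ab]]] := minS z zS.
have [|p [pS pW hp]] := reach_first_hit (P := S) ab.
  apply: contra sepS => ab'; apply/linkedP; exists a, b; split=> //.
  by apply: reach_subset ab' => y; rewrite !inE => /and3P[-> _ ->].
have pz : p = z.
  by apply/eqP; move: pW; rewrite !inE pS andbT negbK => /andP[].
move: hp; rewrite {}pz; case=> [az|[u au uz]].
  by apply: near; [rewrite -az; case/setIP: aA | rewrite inE zS].
have /sidez[x xX xu] : u \in side R X S.
  apply/sideP; exists a => //; apply: reach_subset au => y.
  by rewrite !inE => /and3P[-> _ ->].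
by exists x => //; apply: reach_step xu _ uz; rewrite !inE zS orbT.
Qed.

Lemma ord2_neq0 (i j : 'I_2) : i != ord0 -> j != ord0 -> i = j.
Proof. by case: i j => [[|[|i]] ?] [[|[|j]] ?] // _ _; apply: val_inj. Qed.

(** * The minor obtained from disjoint connectors *)

(** [X] and [Y] are the branch sets of the central edge, and each connector supplies one of the [t]
    common neighbours. *)
Lemma linkage_minor t R X Y :
    connected_set X -> connected_set Y -> [disjoint X & Y] ->
    [disjoint X & R] -> [disjoint Y & R] ->
    (exists x y, [/\ x \in X, y \in Y & adj x y]) ->
    linkage (induced_adj R) (nbhd X :&: R) (nbhd Y :&: R) t ->
  has_minor G (K2star t).
Proof.
move=> cX cY dXY dXR dYR [x0 [y0 [xX yY xy]]] [I [C [tI lC dC]]].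
set A := nbhd X :&: R in lC *; set B := nbhd Y :&: R in lC *.
pose a d := odflt d [pick a in A | linked (@adj G) [set a] B (C d :&: R)].
have aP d : d \in I ->
    a d \in A /\ exists2 b, b \in B & reach_adj (C d :&: R) (a d) b.
  move=> /lC /linkedP[u [v [uA vB uv]]]; rewrite /a.
  have uR : u \in R by case/setIP: uA.
  rewrite reach_induced // in uv.
  case: pickP => [w /andP[wA /linkedP[? [b [/set1P-> bB wb]]]]|/(_ u)/negP[]].
    by split=> //; exists b.
  by rewrite uA; apply/linkedP; exists u, v; rewrite inE eqxx.
(* A connector need not be connected; the component of [a d] in its part inside [R] is, and still
   touches both [X] and [Y]. *)
pose K d := [set z | reach_adj (C d :&: R) (a d) z].
have KC d : K d \subset C d :&: R.
  by apply/subsetP=> z; rewrite inE => /reach_out.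
pose idx (k : 'I_t) := enum_val (widen_ord tI k).
have idxI k : idx k \in I by apply: enum_valP.
pose phi (h : K2star t) : {set G} :=
  match h with inl i => if i == ord0 then X else Y | inr k => K (idx k) end.
have dK Z k : [disjoint Z & R] -> [disjoint Z & K (idx k)].
  by apply: disjointWr; apply: subset_trans (KC _) (subsetIr _ _).
have aK k : a (idx k) \in K (idx k) /\ a (idx k) \in A.
  have [aA [b _ /reach_in ain]] := aP _ (idxI k).
  by rewrite inE reach_refl.
exists phi; split.
- case=> [i|k] /=; first by case: ifP.
  by apply: reached_connected; case: (aP _ (idxI k)) => _ [b _ /reach_in].
- case=> [i|k] [j|l] /=.
  + case: (eqVneq i ord0) => [->|i0]; case: (eqVneq j ord0) => [->|j0] //.
      by rewrite disjoint_sym.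
    by rewrite (ord2_neq0 i0 j0) eqxx.
  + by move=> _; case: ifP => _; apply: dK.
  + by move=> _; rewrite disjoint_sym; case: ifP => _; apply: dK.
  move=> nkl; apply: (disjointW (subset_trans (KC _) (subsetIl _ _))
                                (subset_trans (KC _) (subsetIl _ _))).
  apply: dC => //; apply: contra nkl => /eqP /enum_val_inj /(congr1 val) /= kl.
  by apply/eqP; congr inr; apply: val_inj.
have XK k : exists x y, [/\ x \in X, y \in K (idx k) & adj x y].
  have [aK1 /setIP[/nbhdP[x xX' xa] _]] := aK k.
  by exists x, (a (idx k)).
have YK k : exists x y, [/\ x \in Y, y \in K (idx k) & adj x y].
  have [_ [b /setIP[/nbhdP[y yY' yb] _] ab]] := aP _ (idxI k).
  by exists y, b; rewrite inE.
have flip (U V : {set G}) : (exists x y, [/\ x \in U, y \in V & adj x y]) ->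
    exists x y, [/\ x \in V, y \in U & adj x y].
  by case=> x [y [xU yV uv]]; exists y, x; rewrite adj_sym.
case=> [i|k] [j|l] //=.
- case: (eqVneq i ord0) => [->|i0].
    by case: (eqVneq j ord0) => // _ _; exists x0, y0.
  case: (eqVneq j ord0) => [_|j0] nij.
    by apply: flip; exists x0, y0.
  by case/eqP: nij; apply: ord2_neq0.
- by case: ifP.
by move=> _; apply: flip; case: ifP => _.
Qed.

(** * Clustered colourings of vertex sets *)

(** Bounding all connected monochromatic sets, not just components, lets the bound be combined over
    parts of [R] without recomputing components. *)
Definition clustered (c : G -> 'I_3) R m : Prop :=
  forall K, connected_set K -> K \subset R -> {in K &, forall x y, c x = c y} ->
    #|K| <= m.

Lemma eq_clustered c c' R m :
  {in R, c =1 c'} -> clustered c R m -> clustered c' R m.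
Proof.
move=> cc' cl K cK KR mK; apply: cl => // x y xK yK.
by rewrite (cc' x) ?(cc' y) ?(subsetP KR) ?(mK x y).
Qed.

Lemma clustered_isolated c R m y :
    0 < m -> {in R, forall z, adj y z -> c z != c y} ->
  clustered c R m -> clustered c (y |: R) m.
Proof.
move=> m0 iy cl K cK KR mK.
have KRy z : z \in K -> z != y -> z \in R.
  by move=> /(subsetP KR); rewrite !inE => /orP[->|].
have [yK|yK] := boolP (y \in K).
  suff /subset_leq_card : K \subset [set y] by rewrite cards1 => /leq_trans; apply.
  apply: (connected_closed cK yK); first by rewrite inE.
  move=> u v uK vK /set1P uy; rewrite {}uy in uK *; move=> yv; apply/set1P/eqP.
  by apply/negPn/negP => nvy; case/negP: (iy v (KRy v vK nvy) yv); rewrite (mK v y).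
apply: cl => //; apply/subsetP=> z zK; apply: KRy => //.
by apply: contra yK => /eqP <-.
Qed.

Lemma third_colour (i j : 'I_3) : exists2 l : 'I_3, l != i & l != j.
Proof.
have /card_gt0P[l] : 0 < #|~: [set i; j]|.
  by rewrite cardsCs setCK card_ord subn_gt0 cards2; case: (i != j).
by rewrite !inE negb_or => /andP[li lj]; exists l.
Qed.

(** A connected monochromatic set that meets [S] cannot leave it, by the colour condition; one that
    avoids [S] stays within [R1] or within [R2]. *)
Lemma clustered_pieces c R S R1 R2 m :
    R \subset S :|: (R1 :|: R2) -> #|S| <= m ->
    {in S & R1 :|: R2, forall s z, adj s z -> c z != c s} ->
    {in R1 & R2, forall u v, ~~ adj u v} ->
  clustered c R1 m -> clustered c R2 m -> clustered c R m.
Proof.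
move=> RU Sm cS n12 cl1 cl2 K cK KR mK.
have KU z : z \in K -> z \in S :|: (R1 :|: R2) by move=> /(subsetP KR) /(subsetP RU).
have [/existsP[s /andP[sK sS]]|noS] := boolP [exists s, (s \in K) && (s \in S)].
  apply: leq_trans (subset_leq_card _) Sm.
  apply: (connected_closed cK sK sS) => u v uK vK uS uv.
  case/setUP: (KU v vK) => // v12.
  by have := cS u v uS v12 uv; rewrite (mK v u) ?eqxx.
have K12 z : z \in K -> z \in R1 :|: R2.
  move=> zK; case/setUP: (KU z zK) => // zS.
  by case/existsP: noS; exists z; rewrite zK.
have [/set0Pn[k kK] _] := cK.
case/setUP: (K12 k kK) => kR.
  apply: cl1 => //; apply: (connected_closed cK kK kR) => u v uK vK uR uv.
  by case/setUP: (K12 v vK) => // vR; case/negP: (n12 u v uR vR).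
apply: cl2 => //; apply: (connected_closed cK kK kR) => u v uK vK uR uv.
by case/setUP: (K12 v vK) => // vR; case/negP: (n12 v u vR uR); rewrite adj_sym.
Qed.

(* The adjacency of X and Y is only required when both have neighbours in R, so
   that X or Y may be empty or replaced once it has no neighbour left in R. *)
Lemma colouring_avoiding t R X Y (i j : 'I_3) :
    ~ has_minor G (K2star t) ->
    weakly_connected X -> weakly_connected Y -> [disjoint X & Y] ->
    [disjoint X & R] -> [disjoint Y & R] ->
    (nbhd X :&: R != set0 -> nbhd Y :&: R != set0 ->
       exists x y, [/\ x \in X, y \in Y & adj x y]) ->
    i != j ->
  exists c : G -> 'I_3,
    [/\ {in R, forall z, z \in nbhd X -> c z != i},
        {in R, forall z, z \in nbhd Y -> c z != j}
      & clustered c R (clustering_bound t)].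
Proof.
move=> nominor; have [n] := ubnP #|R|.
elim: n R X Y i j => // n IH R X Y i j Rn cX cY dXY dXR dYR XY ij.
have m0 : 0 < clustering_bound t by rewrite leq_max.
(* With no neighbour of [X1] in [R], only [Y1] imposes a constraint. A vertex [y], adjacent to [Y1]
   if possible, gets a colour [l] other than [j1] and replaces [X1]; the recursion keeps [l] off its
   neighbours, so [y] is isolated. *)
have one_side X1 Y1 i1 j1 : weakly_connected Y1 -> [disjoint Y1 & R] ->
    nbhd X1 :&: R = set0 ->
  exists c : G -> 'I_3,
    [/\ {in R, forall z, z \in nbhd X1 -> c z != i1},
        {in R, forall z, z \in nbhd Y1 -> c z != j1}
      & clustered c R (clustering_bound t)].
  move=> cY1 dY1 X1R.
  have noX z : z \in R -> z \in nbhd X1 -> False.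
    by move=> zR zX; have := in_set0 z; rewrite -X1R in_setI zX zR.
  have [R0|[y0 y0R]] := set_0Vmem R.
    exists (fun=> i1); split=> [z|z|K [/set0Pn[k kK] _] /subsetP/(_ k kK)];
      by rewrite R0 inE.
  have [y yR yY] : exists2 y, y \in R & nbhd Y1 :&: R != set0 -> y \in nbhd Y1.
    have [Y0|[y /setIP[yY yR]]] := set_0Vmem (nbhd Y1 :&: R); last by exists y.
    by exists y0; rewrite ?Y0 ?eqxx.
  have [l _ lj] := third_colour i1 j1.
  have [||||||||c [cY1c cyc cl]] := IH (R :\ y) Y1 [set y] j1 l.
  - by rewrite (cardsD1 y) yR in Rn.
  - by [].
  - by move=> u v /set1P-> /set1P->; apply: reach_refl; rewrite inE.
  - by rewrite disjoint_sym disjoints1 (disjointFl dY1 yR).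
  - by apply: disjointWr dY1; apply: subD1set.
  - by rewrite disjoints1 !inE eqxx.
  - move=> Yn _; have /yY/nbhdP[x xY xy] : nbhd Y1 :&: R != set0.
      apply: contraNneq Yn => Y0; rewrite -subset0 -Y0.
      by apply: setIS; apply: subD1set.
    by exists x, y; rewrite inE.
  - by rewrite eq_sym.
  pose c' z := if z == y then l else c z.
  have cc' : {in R :\ y, c =1 c'}.
    by move=> z; rewrite !inE /c' => /andP[/negPf->].
  exists c'; split=> [z zR /(noX z zR)//|z zR zY|].
    rewrite /c'; case: (eqVneq z y) => // zy.
    by apply: cY1c => //; rewrite !inE zy.
  rewrite -(setD1K yR); apply: clustered_isolated => //; last exact: eq_clustered cl.
  move=> z zR yz; rewrite -cc' // /c' eqxx; apply: cyc => //.
  by apply/nbhdP; exists y; rewrite ?inE.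
have [A0|A1] := eqVneq (nbhd X :&: R) set0; first exact: one_side.
have [B0|B1] := eqVneq (nbhd Y :&: R) set0.
  have [c [c1 c2 c3]] := one_side Y X j i cX dXR B0.
  by exists c.
have [x [y [xX yY xy]]] := XY A1 B1.
have [S [St sepS minS]] : exists S : {set G},
    [/\ #|S| < t,
        ~~ linked (@adj G) (nbhd X :&: R) (nbhd Y :&: R) (R :\: S)
      & {in S, forall s,
          linked (@adj G) (nbhd X :&: R) (nbhd Y :&: R) (R :\: (S :\ s))}].
  have [|S [St sS mS]] := @minimal_separator _ (induced_adj R)
      (nbhd X :&: R) (nbhd Y :&: R) t.
    move=> lk; case: nominor.
    apply: (linkage_minor _ _ dXY dXR dYR _ lk); last by exists x, y.
      exact: weakly_connected_set xX cX.
    exact: weakly_connected_set yY cY.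
  have lR W : linked (induced_adj R) (nbhd X :&: R) (nbhd Y :&: R) (~: W) =
      linked (@adj G) (nbhd X :&: R) (nbhd Y :&: R) (R :\: W).
    apply/linkedP/linkedP => -[a [b [aA bB ab]]]; exists a, b; split=> //;
      by move: ab; rewrite reach_induced ?setDE 1?setIC //; case/setIP: aA.
  exists S; split=> //; first by rewrite -lR.
  by move=> s /mS; rewrite lR.
(* Returning a vertex outside [R] would not change [R :\: S], against minimality. *)
have SR : S \subset R.
  apply/subsetP=> s sS; apply: contraT => sR; case/negP: sepS.
  have := minS s sS; apply: linked_sub => // z; rewrite !inE.
  by have [->|] := eqVneq z s; rewrite ?(negPf sR) ?andbF.
have sepS' : ~~ linked (@adj G) (nbhd Y :&: R) (nbhd X :&: R) (R :\: S).
  apply: contra sepS => /linkedP[a [b [aA bB ab]]]; apply/linkedP; exists b, a.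
  by rewrite reach_adj_sym.
have minS' : {in S, forall s,
    linked (@adj G) (nbhd Y :&: R) (nbhd X :&: R) (R :\: (S :\ s))}.
  move=> s /minS /linkedP[a [b [aA bB ab]]]; apply/linkedP; exists b, a.
  by rewrite reach_adj_sym.
(* [R2] contains [RY] and also the components of [R :\: S] touching neither [X] nor [Y]. *)
pose RX := side R X S; pose RY := side R Y S; pose R2 := R :\: S :\: RX.
have RXs : RX \subset R :\: S := side_sub R X S.
have RYs : RY \subset R :\: S := side_sub R Y S.
have RXR : RX \subset R := subset_trans RXs (subsetDl _ _).
have RYR : RY \subset R := subset_trans RYs (subsetDl _ _).
have R2R : R2 \subset R := subset_trans (subsetDl _ _) (subsetDl _ _).
have RXY z : z \in RX -> z \in nbhd Y -> False.
  move=> zRX zY; case/negP: sepS; case/sideP: (zRX) => a aA az.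
  by apply/linkedP; exists a, z; split; rewrite // in_setI zY (subsetP RXR).
have [l li lj] := third_colour i j.
have cX' : weakly_connected (X :|: (S :|: RX)) by apply: weakly_connected_side sepS minS.
have cY' : weakly_connected (Y :|: (S :|: RY)) by apply: weakly_connected_side sepS' minS'.
have dRXY : [disjoint RX & RY].
  apply/disjoint_setP=> z /sideP[a aA az] /sideP[b bB bz]; case/negP: sepS.
  apply/linkedP; exists a, b; split=> //; apply: reach_trans az _.
  by rewrite reach_adj_sym.
(* [RX] is smaller than [R] because it misses the neighbours of [Y]; for that reason [j] needs no
   exclusion here, and the second set can serve to keep [l] off the neighbours of [S]. *)
have [||||||||c1 [c1X c1Y cl1]] := IH RX X (Y :|: (S :|: RY)) i l.
- have /set0Pn[b /setIP[bY bR]] := B1.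
  rewrite -ltnS; apply: leq_trans Rn; rewrite ltnS; apply: proper_card.
  by apply/properP; split=> //; exists b => //; apply/negP => /RXY; apply.
- exact: cX.
- exact: cY'.
- apply/disjoint_setP=> z zX; rewrite !in_setU => /or3P[zY|zS|zRY].
  + by rewrite (disjointFr dXY zX) in zY.
  + by move: (subsetP SR z zS); rewrite (disjointFr dXR zX).
  + by move: (subsetP RYR z zRY); rewrite (disjointFr dXR zX).
- exact: disjointWr RXR dXR.
- apply/disjoint_setP=> z; rewrite !in_setU => /or3P[zY|zS|zRY] zRX.
  + by move: (subsetP RXR z zRX); rewrite (disjointFr dYR zY).
  + by move: (subsetP RXs z zRX); rewrite inE zS.
  + by rewrite (disjointFr dRXY zRX) in zRY.
- by move=> _ _; exists x, y; rewrite inE yY.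
- by rewrite eq_sym.
(* [R2] is smaller because every neighbour of [X] in [R] lies in [S] or [RX]. *)
have [||||||||c2 [c2Y c2X cl2]] := IH R2 Y (X :|: (S :|: RX)) j l.
- have /set0Pn[a /setIP[aX aR]] := A1.
  rewrite -ltnS; apply: leq_trans Rn; rewrite ltnS; apply: proper_card.
  apply/properP; split=> //; exists a => //; apply/negP => /setDP[aW /negP[]].
  exact: nbhd_side.
- exact: cY.
- exact: cX'.
- apply/disjoint_setP=> z zY; rewrite !in_setU => /or3P[zX|zS|zRX].
  + by rewrite (disjointFr dXY zX) in zY.
  + by move: (subsetP SR z zS); rewrite (disjointFr dYR zY).
  + by move: (subsetP RXR z zRX); rewrite (disjointFr dYR zY).
- exact: disjointWr R2R dYR.
- apply/disjoint_setP=> z; rewrite !in_setU => /or3P[zX|zS|zRX] zR2.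
  + by move: (subsetP R2R z zR2); rewrite (disjointFr dXR zX).
  + by move: zR2; rewrite !in_setD zS andbF.
  + by move: zR2; rewrite in_setD zRX.
- by move=> _ _; exists y, x; rewrite inE xX adj_sym.
- by rewrite eq_sym.
pose c z := if z \in S then l else if z \in RX then c1 z else c2 z.
have inR2 z : z \in R -> z \notin S -> z \notin RX -> z \in R2.
  by move=> zR zS zRX; rewrite !in_setD zR zS zRX.
have cS z : z \in S -> c z = l by rewrite /c => ->.
have cRX : {in RX, c1 =1 c}.
  by move=> z zRX; rewrite /c zRX; case/setDP: (subsetP RXs z zRX) => _ /negPf->.
have cR2 : {in R2, c2 =1 c}.
  by move=> z; rewrite !in_setD /c => /and3P[/negPf-> /negPf-> _].
exists c; split.
- move=> z zR zX; rewrite /c; case: ifPn => // zS; case: ifPn => zRX; first exact: c1X.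
  by case/negP: zRX; apply: nbhd_side; rewrite // inE zS.
- move=> z zR zY; rewrite /c; case: ifPn => // zS; case: ifPn => zRX.
    by case: (RXY z).
  by apply: c2Y => //; apply: inR2.
apply: (@clustered_pieces c R S RX R2).
- apply/subsetP=> z zR; rewrite !in_setU; have [//|zS] := boolP (z \in S).
  by have [//|zRX] := boolP (z \in RX); rewrite inR2.
(* The strict bound [#|S| < t] yields the clustering [t - 1]. *)
- by rewrite leq_max subn1; case: (t) St => // t'; rewrite ltnS => ->; rewrite orbT.
- move=> s z sS /setUP[] zz sz; rewrite (cS s sS).
    by rewrite -cRX //; apply: c1Y => //; apply/nbhdP; exists s; rewrite // !in_setU sS orbT.
  by rewrite -cR2 //; apply: c2X => //; apply/nbhdP; exists s; rewrite // !in_setU sS orbT.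
- move=> u v uRX /setDP[vW /negP vRX]; apply/negP => uv; apply: vRX.
  exact: side_closed uv.
- exact: eq_clustered cl1.
- exact: eq_clustered cl2.
Qed.

(** * From connected sets to components, and the conclusion *)

Lemma clustered_has_clustering c m :
  clustered c setT m -> has_clustering c m.
Proof.
move=> cl k C /imsetP[x xS ->]; set S := colour_class c k in xS *.
have -> : [set y in S | connect (induced_adj S) x y] = [set y | reach_adj S x y].
  apply/setP=> y; rewrite !inE; apply/andP/idP => [[_ xy]|xy].
    by rewrite /reach xS.
  split; last by case/andP: xy.
  by move: (reach_out xy); rewrite inE.
apply: cl; [exact: reached_connected | exact: subsetT |].
move=> y z; rewrite !inE => /reach_out + /reach_out.
by rewrite !inE => /eqP-> /eqP->.
Qed.

End Colouring.

Theorem theorem16 (t : nat) (G : sgraph) :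
  1 <= t ->
  ~ has_minor G (K2star t) ->
  colourable_with_clustering G 3 (clustering_bound t) /\
  (forall v w : G, adj v w ->
     exists c : G -> 'I_3,
       [/\ has_clustering c (clustering_bound t),
           mono_isolated c v
         & mono_isolated c w]).
Proof.
move=> _ nominor; have m0 : 0 < clustering_bound t by rewrite leq_max.
have nbhd0 : nbhd (@set0 G) :&: setT = set0.
  by apply/setP=> z; rewrite !inE andbT; apply/existsP => -[x]; rewrite inE.
split.
  (* Empty sets impose no constraint, so this also covers graphs without edges. *)
  have [|||||||c [_ _ cl]] :=
    @colouring_avoiding G t setT set0 set0 ord0 ord_max nominor.
  - by move=> x y; rewrite inE.
  - by move=> x y; rewrite inE.
  - by apply/disjoint_setP=> z; rewrite inE.
  - by apply/disjoint_setP=> z; rewrite inE.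
  - by apply/disjoint_setP=> z; rewrite inE.
  - by rewrite nbhd0 eqxx.
  - by [].
  by exists c; apply: clustered_has_clustering.
move=> v w vw.
have vNw : v != w by apply: contraTneq vw => ->; rewrite adj_irr.
have single (x : G) : weakly_connected [set x].
  by move=> y z /set1P-> /set1P->; apply: reach_refl; rewrite inE.
pose R := ~: [set v; w].
have [|||||||c0 [cv cw cl]] :=
  @colouring_avoiding G t R [set v] [set w] ord0 ord_max nominor.
- exact: single.
- exact: single.
- by rewrite disjoints1 inE.
- by rewrite disjoints1 !inE eqxx.
- by rewrite disjoints1 !inE eqxx orbT.
- by move=> _ _; exists v, w; rewrite !inE.
- by [].
(* Each of [v] and [w] receives exactly the colour that [c0] avoids on its neighbours. *)
pose c z : 'I_3 := if z == v then ord0 else if z == w then ord_max else c0 z.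
have Rc : {in R, c0 =1 c}.
  by move=> z; rewrite !inE negb_or /c => /andP[/negPf-> /negPf->].
have c_v : c v = ord0 by rewrite /c eqxx.
have c_w : c w = ord_max by rewrite /c eq_sym (negPf vNw) eqxx.
have cvR z : adj v z -> c z != c v.
  move=> vz; rewrite c_v; have [->|zw] := eqVneq z w; first by rewrite c_w.
  have zR : z \in R.
    by rewrite !inE negb_or zw andbT; apply: contraTneq vz => ->; rewrite adj_irr.
  by rewrite -Rc // cv //; apply/nbhdP; exists v; rewrite ?inE.
have cwR z : adj w z -> c z != c w.
  move=> wz; rewrite c_w; have [->|zv] := eqVneq z v; first by rewrite c_v.
  have zR : z \in R.
    by rewrite !inE negb_or zv; apply: contraTneq wz => ->; rewrite adj_irr.
  by rewrite -Rc // cw //; apply/nbhdP; exists w; rewrite ?inE.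
exists c; split.
- apply: clustered_has_clustering.
  (* [w] and then [v] are added back as isolated vertices. *)
  have -> : setT = v |: (w |: R).
    by apply/setP=> z; rewrite !inE; case: (z == v); case: (z == w).
  apply: clustered_isolated => //; first by move=> z _; apply: cvR.
  apply: clustered_isolated => //; first by move=> z _; apply: cwR.
  exact: eq_clustered cl.
- by move=> x; rewrite inE; apply: contraL => /cvR.
- by move=> x; rewrite inE; apply: contraL => /cwR.
Qed.
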